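(* Let $2<p<\infty$ and $\frac1p+\frac1q=1$. Let $\bar x=(\bar t_1,\bar t_2,\dots)\in l_p\setminus\{\theta\}$ with $|\mathcal N(\bar x)|<\infty$, and let $\bar y\in l_q$ with $\bar y=J(\bar x)$, where $J:l_p\to l_q$ is the normalized duality mapping. Then $J$ is Mordukhovich differentiable at $(\bar x,\bar y)$ and, for any $v=\{s_n\}_{n=1}^\infty\in l_p\setminus\{\theta\}$ with ratio sequence $\{\lambda_n\}_{n=1}^\infty$ with respect to $\bar x$, one has $$\widehat D^*J(\bar x,\bar y)(v)=\nabla J(\bar x)(v)=J(\bar x)\left((p-1)\begin{pmatrix}\lambda_1&0&\cdots\\0&\lambda_2&0\\\vdots&0&\ddots\end{pmatrix}-\frac{(p-2)\sum_{i=1}^\infty\lambda_i|\bar t_i|^p}{\sum_{i=1}^\infty|\bar t_i|^p}\begin{pmatrix}1&0&\cdots\\0&1&0\\\vdots&0&\ddots\end{pmatrix}\right).$$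
   Context: $(l_p,\|\cdot\|_p)$ and $(l_q,\|\cdot\|_q)$ are the real sequence spaces, $l_p^*=l_q$, $l_q^*=l_p$, $\theta=(0,0,\dots)$, and $\langle\cdot,\cdot\rangle$ is the canonical real pairing $\sum_n a_nb_n$ of elements of $l_q$ and $l_p$. The normalized duality mapping $J:l_p\to l_q$ is given by $J(\theta)=\theta$ and, for $x=(t_1,t_2,\dots)\neq\theta$, $J(x)=\left\{\frac{|t_n|^{p-1}\mathrm{sign}(t_n)}{\|x\|_p^{p-2}}\right\}_{n=1}^\infty$. For a real sequence $x=(t_n)$, $\mathcal N(x)=\{n\in\mathbb N:t_n\ne0\}$ and $|\mathcal N(x)|$ is its cardinality. For real sequences $\bar x=(\bar t_n)$ and $v=(s_n)$, the ratio sequence $\{\lambda_n\}$ of $v$ with respect to $\bar x$ is defined by $\lambda_n=0$ if $\bar t_n=0$ and $\lambda_n=s_n/\bar t_n$ if $\bar t_n\ne0$. A sequence times an infinite diagonal matrix is computed as a row vector times the matrix (entrywise multiplication by the diagonal entries). $\nabla J(\bar x):l_p\to l_q$ denotes the Fréchet derivative of $J$ at $\bar x$. The Mordukhovich derivative (Fréchet coderivative) of $J$ at $(\bar x,J(\bar x))$ is the set-valued map $\widehat D^*J(\bar x,J(\bar x)):l_p\rightrightarrows l_q$, $$\widehat D^*J(\bar x,J(\bar x))(y)=\left\{z\in l_q:\limsup_{u\to\bar x,\,u\in l_p}\frac{\langle z,u-\bar x\rangle-\langle y,J(u)-J(\bar x)\rangle}{\|u-\bar x\|_p+\|J(u)-J(\bar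 x)\|_q}\le0\right\},\quad y\in l_p.$$ $J$ is Mordukhovich differentiable at $(\bar x,J(\bar x))$ if this set is a singleton for every $y\in l_p$; the singleton is then identified with its unique element. *)

(* Defs.v *)
From HB Require Import structures.
From mathcomp Require Import all_boot all_order all_algebra.
From mathcomp Require Import all_classical all_reals all_analysis.

Set Implicit Arguments.
Unset Strict Implicit.
Unset Printing Implicit Defensive.
Import Order.TTheory GRing.Theory Num.Theory.
Import numFieldNormedType.Exports.

Local Open Scope classical_set_scope.
Local Open Scope ring_scope.

(* The sequences with finite p-norm for the counting measure on nat. No quotient
   is needed, as almost-everywhere equality is equality for this measure. *)
Definition ell (R : realType) (p : R) (p1 : (1 <= p%:E)%E) : Type :=
  LfunType (counting : {measure set nat -> \bar R}) p1.

Section ell_normed.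
Context (R : realType) (p : R) (p1 : (1 <= p%:E)%E).
Local Notation E := (ell p1).
Local Notation mu := (counting : {measure set nat -> \bar R}).

HB.instance Definition _ := GRing.Lmodule.on E.

Definition ell_norm (x : E) : R := fine ('N[mu]_(p%:E) [EFin \o x])%E.

Lemma ell_normD (x y : E) : ell_norm (x + y) <= ell_norm x + ell_norm y.
Proof. exact: ler_LnormD. Qed.

Lemma ell_normZ (a : R) (x : E) : ell_norm (a *: x) = `|a| * ell_norm x.
Proof.
apply: EFin_inj; rewrite EFinM [LHS]finite_norm_fine.
by rewrite [X in (_ * X)%E]finite_norm_fine; exact: LnormZ.
Qed.

Lemma ell_exponent_gt0 : 0 < p.
Proof. by move: p1; rewrite lee_fin; exact: lt_le_trans. Qed.

Lemma cvg_ell_normX (x : E) :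
  series (fun n => `|x n| `^ p) @ \oo --> ell_norm x `^ p.
Proof.
have cv : cvgn (fun n => \sum_(0 <= k < n) (`|x k| `^ p)%:E)%E.
  by apply: is_cvg_nneseries => n _ _; rewrite lee_fin powR_ge0.
have e : ((ell_norm x `^ p)%:E = \sum_(k <oo) (`|x k| `^ p)%:E)%E.
  rewrite -poweR_EFin finite_norm_fine poweR_Lnorm ?gt_eqF ?ell_exponent_gt0//.
  by rewrite ge0_integral_count// => k; rewrite poweR_ge0.
have : (fun n => \sum_(0 <= k < n) (`|x k| `^ p)%:E)%E @ \oo -->
    (ell_norm x `^ p)%:E by rewrite e; exact: cv.
move=> /fine_cvgP[_]; apply: cvg_trans; apply: near_eq_cvg.
by apply: nearW => n; rewrite /= sumEFin.
Qed.

Lemma ell_normE (x : E) :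
  ell_norm x = limn (series (fun n => `|x n| `^ p)) `^ p^-1.
Proof.
have -> : limn (series (fun n => `|x n| `^ p)) = ell_norm x `^ p.
  by apply: cvg_lim => //; exact: cvg_ell_normX.
rewrite -powRrM mulfV ?gt_eqF ?ell_exponent_gt0//.
by rewrite powRr1// fine_ge0// Lnorm_ge0.
Qed.

Lemma ell_norm_eq0 (x : E) : ell_norm x = 0 -> x = 0.
Proof.
move=> x0; apply/LfuneqP => n /=; apply/eqP; rewrite -normr_eq0.
have cv : series (fun n => `|x n| `^ p) @ \oo --> (0 : R).
  rewrite -(_ : ell_norm x `^ p = 0); first exact: cvg_ell_normX.
  by rewrite x0 powR0// gt_eqF ?ell_exponent_gt0.
have nd : nondecreasing_seq (series (fun n => `|x n| `^ p)).
  by apply: nondecreasing_series => i _ _; exact: powR_ge0.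
have := nondecreasing_cvgn_le nd (cvgP _ cv) n.+1.
rewrite (_ : limn _ = 0); last exact: cvg_lim.
rewrite seriesEnat /= big_nat_recr//= => le0.
apply/eqP; apply: (powR_eq0_eq0 (p := p)).
apply/eqP; rewrite eq_le powR_ge0 andbT (le_trans _ le0)// lerDr.
by apply: sumr_ge0 => i _; exact: powR_ge0.
Qed.

HB.instance Definition _ :=
  Lmodule_isNormed.Build R E ell_normD ell_normZ ell_norm_eq0.

Lemma ell_norm_def (x : E) : `|x| = ell_norm x. Proof. by []. Qed.

Lemma ell_mem (u : nat -> R) :
  cvgn (series (fun n => `|u n| `^ p)) -> u \in Lfun mu p%:E.
Proof.
move=> cu; rewrite inE; apply/andP; split; rewrite inE//=.
rewrite /finite_norm Lnorm_counting ?ell_exponent_gt0//.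
apply: poweR_lty; rewrite (_ : (fun n => _) =
  EFin \o series (fun n => `|u n| `^ p)); last first.
  by apply/funext => n; rewrite /= -sumEFin.
by rewrite EFin_lim// ltry.
Qed.

Definition ell_of (u : nat -> R)
  (cu : cvgn (series (fun n => `|u n| `^ p))) : E := Lfun_Sub p1 (ell_mem cu).

Lemma ell_ofE u cu : @ell_of u cu = u :> (nat -> R).
Proof. by []. Qed.

End ell_normed.

Section duality_mapping.
Context (R : realType) (p q : R) (p1 : (1 <= p%:E)%E) (q1 : (1 <= q%:E)%E).
Hypothesis pq : p^-1 + q^-1 = 1.

Definition duality_seq (x : ell p1) : nat -> R :=
  if x == 0 then fun=> 0
  else fun n => `|x n| `^ (p - 1) * Num.sg (x n) / `|x| `^ (p - 2).

Lemma conjugate_mul : (p - 1) * q = p.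
Proof.
have p0 := ell_exponent_gt0 p1; have q0 := ell_exponent_gt0 q1.
have : p * q * (p^-1 + q^-1) = p * q by rewrite pq mulr1.
rewrite mulrDr [p * q / p]mulrAC divff ?gt_eqF// mul1r mulfK ?gt_eqF//.
by rewrite mulrBl mul1r => <-; rewrite [q + p]addrC addrK.
Qed.

Lemma duality_seq_cvg (x : ell p1) :
  cvgn (series (fun n => `|duality_seq x n| `^ q)).
Proof.
have q0 := ell_exponent_gt0 q1.
rewrite /duality_seq; case: ifPn => x0.
  rewrite (_ : series _ = cst 0); first exact: is_cvg_cst.
  apply/funext => n; rewrite seriesEnat /= big1// => i _.
  by rewrite normr0 powR0 ?gt_eqF.
have pm1 : p - 1 != 0.
  apply/eqP => e; have := conjugate_mul; rewrite e mul0r => p0.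
  by have := ell_exponent_gt0 p1; rewrite -p0 ltxx.
pose c := (`|x| `^ (p - 2))^-1.
rewrite (_ : series _ =
    `|c| `^ q *: series (fun n => `|x n| `^ p)); last first.
  rewrite -seriesZ; congr series; apply/funext => n /=.
  rewrite !normrM (ger0_norm (powR_ge0 _ _)) -/c.
  rewrite powRM ?mulr_ge0 ?powR_ge0// mulrC; congr (_ * _).
  have [->|xn0] := eqVneq (x n) 0.
    rewrite sgr0 normr0 mulr0 !powR0 ?gt_eqF//.
    exact: ell_exponent_gt0 p1.
  by rewrite normr_sg xn0 mulr1 -powRrM conjugate_mul.
by apply: is_cvgZl_tmp; apply: cvgP; exact: cvg_ell_normX.
Qed.

Definition duality_mapping (x : ell p1) : ell q1 :=
  ell_of q1 (@duality_seq_cvg x).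

End duality_mapping.
Arguments duality_mapping {R p q p1 q1} pq x.

Section conjugate_exponents.
Context (R : realType) (p q : R).

Lemma p_ge1 : 2 < p -> (1 <= p%:E)%E.
Proof. by move=> p2; rewrite lee_fin (le_trans _ (ltW p2))// ler1n. Qed.

Lemma q_ge1 : 2 < p -> p^-1 + q^-1 = 1 -> (1 <= q%:E)%E.
Proof.
move=> p2 pq; have p0 : 0 < p by apply: lt_trans p2.
have p1 : 1 < p by apply: lt_trans p2; rewrite ltr1n.
have qE : q^-1 = 1 - p^-1 by rewrite -pq [p^-1 + _]addrC addrK.
have q0 : 0 < q^-1 by rewrite qE subr_gt0 invf_lt1.
by rewrite lee_fin -[q]invrK invf_ge1// qE gerBl invr_ge0 ltW.
Qed.

End conjugate_exponents.

Section mordukhovich.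
Context (R : realType).

Definition pairing (a b : nat -> R) : R := limn (series (fun n => a n * b n)).

(* The dual of l_p is l_q and the dual of l_q is l_p, so the coderivative of
   f : l_p -> l_q at the graph point (xbar, ybar), where ybar = f xbar, maps
   l_p to subsets of l_q. The upper limit is over u != xbar, for which the
   denominator is nonzero. *)
Definition mordukhovich_derivative (p q : R)
    (p1 : (1 <= p%:E)%E) (q1 : (1 <= q%:E)%E)
    (f : ell p1 -> ell q1) (xbar : ell p1) (ybar : ell q1) (y : ell p1) :
    set (ell q1) :=
  [set z : ell q1 |
    (limf_esup (fun u : ell p1 =>
       ((pairing z (u - xbar) - pairing y (f u - ybar))
        / (`|u - xbar| + `|f u - ybar|))%:E) xbar^' <= 0)%E].

Definition mordukhovich_differentiable (p q : R)
    (p1 : (1 <= p%:E)%E) (q1 : (1 <= q%:E)%E)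
    (f : ell p1 -> ell q1) (xbar : ell p1) (ybar : ell q1) : Prop :=
  forall y : ell p1, exists z : ell q1,
    mordukhovich_derivative f xbar ybar y = [set z].

End mordukhovich.

Section sequences_and_matrices.
Context (R : realType).

Definition nonzero_indices (x : nat -> R) : set nat := [set n | x n != 0].

Definition ratio_seq (v xbar : nat -> R) : nat -> R :=
  fun n => if xbar n == 0 then 0 else v n / xbar n.

Definition inf_diag (d : nat -> R) : nat -> nat -> R :=
  fun i j => if i == j then d i else 0.

Definition rowseq_mul (x : nat -> R) (A : nat -> nat -> R) : nat -> R :=
  fun j => limn (series (fun i => x i * A i j)).

Lemma rowseq_mul_diag (x d : nat -> R) :
  rowseq_mul x (inf_diag d) = (fun n => x n * d n).
Proof.
apply/funext => j; rewrite /rowseq_mul; apply: cvg_lim => //.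
apply: cvg_near_cst; exists j.+1 => // n /= jn.
rewrite seriesEnat /= (big_cat_nat (n := j.+1))//= big_nat_recr//=.
rewrite /inf_diag eqxx big_nat big1 ?add0r; last first.
  by move=> i /andP[_ ij]; rewrite ltn_eqF// mulr0.
rewrite big_nat big1 ?addr0// => i /andP[ij _].
by rewrite gtn_eqF// mulr0.
Qed.

End sequences_and_matrices.

(* Main.v *)
Require Import Defs.
From HB Require Import structures.
From mathcomp Require Import all_boot all_order all_algebra.
From mathcomp Require Import all_classical all_reals all_analysis ring.

Set Implicit Arguments.
Unset Strict Implicit.
Unset Printing Implicit Defensive.
Import Order.TTheory GRing.Theory Num.Theory.
Import numFieldNormedType.Exports.

Local Open Scope classical_set_scope.
Local Open Scope ring_scope.

(** Write [Phi u] for the sequence [|u n| ^ (p - 1) * sg (u n)], so that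
    [J u = (|u| ^ p) ^ ((2 - p) / p) *: Phi u].  Let [s] enumerate the finite
    support of [xbar], and let [tail s u] be [u] with its coordinates in [s]
    replaced by zero.  Both factors of [J u] split along [s]:

      [|u| ^ p = \sum_(k <- s) |u k| ^ p + |tail s u| ^ p],
      [Phi u = \sum_(k <- s) (Phi u) k *: e_k + Phi (tail s u)].

    The finite sums involve scalar powers at the nonzero numbers [xbar k], where
    these are differentiable.  The map [tail s] is bounded, linear and kills
    [xbar], and the norms of the tail terms are powers of [|tail s u|]: the
    exponent is [p] for the first one, and [p - 1], which exceeds 1 because
    [p > 2], for the second one, as [|Phi w| = |w| ^ (p - 1)].  By the chain
    rule both have zero derivative at [xbar].  The product rule then gives the
    derivative of [J] at [xbar] ([is_diff_duality_mapping]), in a form that is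
    visibly symmetric for the pairing ([duality_derivative_symmetric]); the
    announced matrix formula is the same expression rewritten coordinate by
    coordinate ([duality_derivativeE]).

    For a map [f] that is Frechet differentiable at [x], the coderivative at [y]
    consists of the single element that represents [h |-> <y, 'd f x h>], when
    there is one ([mordukhovich_derivative_differentiable]): the remainder of
    [f] is absorbed by the denominator, and any other candidate [z'] would make
    a nonzero continuous linear form negligible compared with the norm, which
    fails along a multiple of a unit sequence.  Symmetry of the derivative of
    [J] identifies this element with ['d J xbar v]. *)

(** * Differential calculus in normed modules *)

Section differential_calculus.
Context (R : realType) (V W : normedModType R).

Lemma is_diff_bounded_linear (f : {linear V -> W}) (C : R) (x : V) :
  (forall h, `|f h| <= C * `|h|) -> is_diff x f f.
Proof.
move=> fC; have cf : continuous f.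
  apply/bounded_linear_continuous/linear_boundedP; near=> r => h.
  by rewrite (le_trans (fC h))// ler_wpM2r.
by apply: DiffDef; [exact: linear_differentiable|exact: diff_lin].
Unshelve. all: by end_near. Qed.

Lemma differentiable_remainder (f : V -> W) (x : V) :
  differentiable f x -> forall e : R, 0 < e ->
  \forall u \near x, `|f u - f x - 'd f x (u - x)| <= e * `|u - x|.
Proof.
move=> /diffE dfx e e0; rewrite lim_id in dfx.
near=> u; rewrite {1}dfx -addrA -opprD [X in X - _]addrC addrK.
by near: u; apply: littleoP.
Unshelve. all: by end_near. Qed.

(** Growth of order [a > 1] at the origin leaves no linear part.  It is applied
    to the terms of the duality mapping supported off the support of the base
    point. *)
Lemma is_diff0_superlinear (f : V -> W) (a : R) :
  1 < a -> (forall u, `|f u| <= `|u| `^ a) -> is_diff 0 f (fun=> 0).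
Proof.
move=> a1 fa; have a0 : 0 < a by apply: lt_trans a1.
have f0 : f 0 = 0.
  apply/normr0_eq0/eqP; rewrite eq_le normr_ge0 andbT (le_trans (fa 0))//.
  by rewrite normr0 powR0 ?gt_eqF.
have o0 : f \o shift 0 = cst (f 0) + (\0 : V -> W) +o_ (0 : V) id.
  rewrite f0; apply/eqaddoP => e e0.
  near=> u; rewrite (_ : _ u = f u); last first.
    by rewrite !fctE /= addr0 [X in _ - X]addr0 subr0.
  apply: (le_trans (fa u)); rewrite -mulr_powRB1// mulrC ler_wpM2r//.
  (* [`|u| ^ (a - 1) <= e] as soon as [`|u| <= e ^ ((a - 1)^-1)] *)
  rewrite -[e]powRr1 ?(ltW e0)// -[X in e `^ X](@mulVf _ (a - 1));
    last by rewrite gt_eqF ?subr_gt0.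
  rewrite powRrM; apply: ge0_ler_powR;
    rewrite ?nnegrE ?powR_ge0 ?subr_ge0 ?(ltW a1)//.
  near: u; apply: (filterS _ (nbhs0_lt (V := V) (powR_gt0 (a - 1)^-1 e0))).
  by move=> u /= /ltW.
have c0 : continuous (\0 : V -> W) by move=> ?; exact: cvg_cst.
have d0 := diff_unique (df := [the {linear V -> W} of \0]) c0 o0.
split; last by rewrite d0.
by apply/diff_locallyP; rewrite d0.
Unshelve. all: by end_near. Qed.

Lemma is_diff_sum (I : eqType) (s : seq I) (f df : I -> V -> W) (x : V) :
  (forall i, i \in s -> is_diff x (f i) (df i)) ->
  is_diff x (fun u => \sum_(i <- s) f i u) (fun h => \sum_(i <- s) df i h).
Proof.
elim: s => [_|i s IH dfs].
  rewrite (_ : (fun=> _) = cst 0); last by apply/funext => u; rewrite big_nil.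
  apply: is_diff_eq; apply/funext => u; by rewrite big_nil.
have di := dfs i (mem_head _ _).
have ds := IH (fun j js => dfs j (mem_behead (s := i :: s) js)).
rewrite (_ : (fun u => _) = f i + fun u => \sum_(j <- s) f j u); last first.
  by apply/funext => u; rewrite big_cons.
by apply: is_diff_eq; apply/funext => u; rewrite [RHS]big_cons.
Qed.

(** The product rule for a scalar function times a vector function, obtained
    from the differential of the continuous bilinear map [(c, w) |-> c *: w]. *)
Lemma is_diff_scale (k dk : V -> R) (f df : V -> W) (x : V) :
  is_diff x k dk -> is_diff x f df ->
  is_diff x (fun u => k u *: f u) (fun h => k x *: df h + dk h *: f x).
Proof.
move=> dkx dfx.
have bil : bilinear_for (GRing.Scale.Law.clone _ _ *:%R _)
    (GRing.Scale.Law.clone _ _ *:%R _) (@GRing.scale R W : R -> W -> W).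
  split=> [u|u] a y z /=.
    by rewrite scalerDl scalerA.
  by rewrite scalerDr !scalerA mulrC.
pose M := bilinear_isBilinear.Build R R W W _ _ (@GRing.scale R W) bil.
pose B : {bilinear R -> W -> W} := HB.pack (@GRing.scale R W) M.
have cB : continuous (fun z : R * W => B z.1 z.2) by exact: scale_continuous.
have dB : is_diff (k x, f x) (fun z : R * W => B z.1 z.2)
   (fun z : R * W => B (k x) z.2 + B z.1 (f x)).
  apply: DiffDef; first exact: differentiable_bilin.
  by rewrite diff_bilin.
exact: (@is_diff_comp _ _ _ _ (fun u => (k u, f u)) _ _ _ x _ dB).
Qed.

End differential_calculus.

(** * Sequences with finite support and coordinates in l_p *)

Section finite_support_series.
Context (R : realType).

Lemma cvg_series_finite_support (s : seq nat) (f : nat -> R) :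
  uniq s -> (forall n, n \notin s -> f n = 0) ->
  series f @ \oo --> \sum_(k <- s) f k.
Proof.
move=> us f0; apply: cvg_near_cst; exists (\max_(k <- s) k).+1 => // n /= sn.
rewrite seriesEnat /= (bigID (fun k => k \in s))/= [X in _ + X]big1 ?addr0//.
rewrite -big_filter; apply: perm_big; apply: uniq_perm => //.
  by rewrite filter_uniq// iota_uniq.
move=> k; rewrite mem_filter mem_index_iota leq0n /=.
have [ks|//] := boolP (k \in s).
by rewrite (leq_ltn_trans _ sn)// (@leq_bigmax_seq _ s (fun=> true) id k).
Qed.

End finite_support_series.

Section unit_sequences.
Context (R : realType) (p : R) (p1 : (1 <= p%:E)%E).
Implicit Types (u v : ell p1) (s : seq nat).

Lemma unit_sequence_cvg k :
  cvgn (series (fun n => `|(n == k)%:R : R| `^ p)).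
Proof.
apply: cvgP; apply: (@cvg_series_finite_support _ [:: k]) => // n.
rewrite inE => /negbTE ->; rewrite normr0 powR0// gt_eqF//.
exact: ell_exponent_gt0 p1.
Qed.

Definition unit_sequence k : ell p1 :=
  @ell_of _ _ p1 (fun n => (n == k)%:R) (@unit_sequence_cvg k).

Lemma ell_sumE s (c : nat -> ell p1) n :
  (\sum_(k <- s) c k) n = \sum_(k <- s) c k n.
Proof. by elim: s => [|k s IH]; rewrite ?big_nil// !big_cons -IH. Qed.

Lemma sum_unit_sequenceE s (c : nat -> R) n : uniq s ->
  (\sum_(k <- s) c k *: unit_sequence k) n = if n \in s then c n else 0.
Proof.
move=> us; rewrite ell_sumE; case: ifPn => ns.
  rewrite (bigD1_seq n)//= big1 ?addr0; last first.
    by move=> k kn; rewrite -[LHS]/(c k * (n == k)%:R) eq_sym (negbTE kn) mulr0.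
  by rewrite -[LHS]/(c n * (n == n)%:R) eqxx mulr1.
rewrite big_seq big1// => k ks; rewrite -[LHS]/(c k * (n == k)%:R).
by rewrite (_ : n == k = false) ?mulr0//; apply: contraNF ns => /eqP ->.
Qed.

Lemma normr_ellX u : `|u| `^ p = limn (series (fun n => `|u n| `^ p)).
Proof. by apply/esym/cvg_lim => //; exact: cvg_ell_normX. Qed.

Lemma ell_coord_le u n : `|u n| <= `|u|.
Proof.
have p0 := ell_exponent_gt0 p1.
have cu := @cvg_ell_normX _ _ p1 u.
have nd : nondecreasing_seq (series (fun n => `|u n| `^ p)).
  by apply: nondecreasing_series => i _ _; exact: powR_ge0.
have := nondecreasing_cvgn_le nd (cvgP _ cu) n.+1.
rewrite -normr_ellX seriesEnat /= big_nat_recr//= => le_u.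
have {}le_u : `|u n| `^ p <= `|u| `^ p.
  rewrite (le_trans _ le_u)// lerDr.
  by apply: sumr_ge0 => i _; exact: powR_ge0.
rewrite leNgt; apply/negP => lt_u; move: le_u; rewrite leNgt => /negP; apply.
by apply: gt0_ltr_powR; rewrite ?nnegrE.
Qed.

(** A named function, so that it can carry a linear structure. *)
Definition ell_coord n u : R := u n.

Lemma ell_coord_is_linear n : linear (ell_coord n).
Proof. by []. Qed.

HB.instance Definition _ n :=
  GRing.isLinear.Build R (ell p1) R *%R (ell_coord n) (ell_coord_is_linear n).

Lemma is_diff_ell_coord n u : is_diff u (ell_coord n) (ell_coord n).
Proof.
by apply: (@is_diff_bounded_linear _ _ _ _ 1) => h; rewrite mul1r ell_coord_le.
Qed.

Lemma unit_sequence_norm k : `|unit_sequence k| = 1.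
Proof.
rewrite ell_norm_def ell_normE.
rewrite (_ : limn _ = 1 :> R) ?powR1//; apply: cvg_lim => //.
have := @cvg_series_finite_support R [:: k] (fun n => `|(n == k)%:R : R| `^ p).
rewrite big_seq1 eqxx normr1 powR1; apply => // n.
rewrite inE => /negbTE ->; rewrite normr0 powR0// gt_eqF//.
exact: ell_exponent_gt0 p1.
Qed.

End unit_sequences.
Arguments unit_sequence {R p} p1 k.

(** * The pairing of l_p and l_q *)

Section pairing.
Context (R : realType) (p q : R) (p1 : (1 <= p%:E)%E) (q1 : (1 <= q%:E)%E).
Hypothesis pq : p^-1 + q^-1 = 1.
Implicit Types (a : ell p1) (b c : ell q1).

Lemma pairingC (x y : nat -> R) : pairing x y = pairing y x.
Proof.
by rewrite /pairing; congr (limn (series _)); apply/funext => n; rewrite mulrC.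
Qed.

(** Hoelder's inequality for the counting measure, kept at the level of partial
    sums: it yields both the convergence of the pairing and its bound. *)
Lemma holder_partial_sum a b n :
  \sum_(0 <= k < n) `|a k * b k| <= `|a| * `|b|.
Proof.
have mf (x : nat -> R) : measurable_fun setT x by [].
have := hoelder (counting : {measure set nat -> \bar R}) (mf a) (mf b)
  (ell_exponent_gt0 p1) (ell_exponent_gt0 q1) pq.
rewrite Lnorm_counting// invr1 poweRe1; last first.
  by apply: nneseries_ge0 => k _ _; exact: poweR_ge0.
rewrite -[X in (_ <= X * _)%E](finite_norm_fine a).
rewrite -[X in (_ <= _ * X)%E](finite_norm_fine b) => le_ab.
rewrite -lee_fin (le_trans _ le_ab)// -sumEFin.
under [leRHS]eq_eseriesr => k _ do rewrite poweRe1//.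
by apply: nneseries_lim_ge => k _ _; rewrite /= lee_fin.
Qed.

Lemma cvg_pairing a b : series (fun n => a n * b n) @ \oo --> pairing a b.
Proof.
apply: normed_cvg; apply: nondecreasing_is_cvgn.
  by apply: nondecreasing_series => i _ _; exact: normr_ge0.
exists (`|a| * `|b|) => _ [n _ <-].
rewrite /normed_series_of seriesEnat; exact: holder_partial_sum.
Qed.

Lemma pairing_le a b : `|pairing a b| <= `|a| * `|b|.
Proof.
have cab : (fun n => `|series (fun k => a k * b k) n|) @ \oo --> `|pairing a b|.
  by apply: cvg_norm; exact: cvg_pairing.
rewrite -(cvg_lim _ cab)//; apply: limr_le; first exact: cvgP cab.
near=> n; rewrite seriesEnat (le_trans (ler_norm_sum _ _ _))//.
exact: holder_partial_sum.
Unshelve. all: by end_near. Qed.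

Lemma pairingDr a b c : pairing a (b + c) = pairing a b + pairing a c.
Proof.
apply: cvg_lim => //; rewrite (_ : series _ =
  series (fun n => a n * b n) + series (fun n => a n * c n)); last first.
  rewrite -seriesD; congr series; apply/funext => n; exact: mulrDr.
by apply: cvgD; exact: cvg_pairing.
Qed.

Lemma pairingZr a b (r : R) : pairing a (r *: b) = r * pairing a b.
Proof.
apply: cvg_lim => //; rewrite (_ : series _ =
  r *: series (fun n => a n * b n)); last first.
  rewrite -seriesZ; congr series; apply/funext => n; exact: mulrCA.
by apply: cvgZl_tmp; exact: cvg_pairing.
Qed.

Lemma pairingBr a b c : pairing a (b - c) = pairing a b - pairing a c.
Proof. by rewrite pairingDr -scaleN1r pairingZr mulN1r. Qed.

Lemma pairing_sum_unit_sequence a (s : seq nat) (c : nat -> R) : uniq s ->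
  pairing a (\sum_(k <- s) c k *: unit_sequence q1 k) =
  \sum_(k <- s) c k * a k.
Proof.
move=> us; apply: cvg_lim => //.
rewrite (_ : \sum_(k <- s) c k * a k = \sum_(k <- s) a k *
    (\sum_(k <- s) c k *: unit_sequence q1 k) k); last first.
  rewrite big_seq [RHS]big_seq; apply: eq_bigr => k ks.
  by rewrite sum_unit_sequenceE// ks mulrC.
apply: cvg_series_finite_support => // n /negbTE ns.
by rewrite sum_unit_sequenceE// ns mulr0.
Qed.

End pairing.

(** * The coderivative of a differentiable map *)

Section coderivative.
Context (R : realType).

(** Reduces the upper limit that defines the coderivative to an epsilon
    condition on real numbers. *)
Lemma limf_esup_le0P (T : choiceType) (X : filteredType T) (g : X -> R)
    (F : set_system X) : Filter F ->
  (limf_esup (fun u => (g u)%:E) F <= 0)%E <->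
  forall e, 0 < e -> \forall u \near F, g u <= e.
Proof.
move=> FF; split=> [le0 e e0|gF].
  have /ereal_inf_lt[_ [A FA <-] supA] :
    (limf_esup (fun u => (g u)%:E) F < e%:E)%E by rewrite (le_lt_trans le0).
  apply: filterS FA => u Au; rewrite -lee_fin (le_trans _ (ltW supA))//.
  by apply: ereal_sup_ubound; exists u.
apply/lee_addgt0Pr => e e0; rewrite add0e.
apply: (@le_trans _ _ (ereal_sup ((fun u => (g u)%:E) @` [set u | g u <= e]))).
  by apply: ereal_inf_lbound; exists [set u | g u <= e] => //; exact: gF.
by apply: ge_ereal_sup => _ [u gu <-]; rewrite lee_fin.
Qed.

Context (p q : R) (p1 : (1 <= p%:E)%E) (q1 : (1 <= q%:E)%E).
Hypothesis pq : p^-1 + q^-1 = 1.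

Let qp : q^-1 + p^-1 = 1. Proof. by rewrite addrC. Qed.

(** A one-sided bound suffices, because the coordinate direction that detects
    [w n] may be followed with either sign. *)
Lemma pairing_superlinear_eq0 (x : ell p1) (w : ell q1) :
  (forall e, 0 < e ->
    \forall u \near x^', pairing w (u - x) <= e * `|u - x|) -> w = 0.
Proof.
move=> small; apply/LfuneqP => n; apply: contrapT => /eqP wn0.
have d0 : 0 < `|w n| by rewrite normr_gt0.
have /small : 0 < `|w n| / 2 by rewrite divr_gt0.
rewrite near_withinE => /nbhs_normP[r r0 ballr]; rewrite /= in r0.
(* [x + t e_n] lies in the ball of radius [r], and there the pairing equals
   [`|w n| * `|t|], twice what the assumed bound allows *)
pose t := r / 2 * Num.sg (w n).
have t_norm : `|t| = r / 2.
  by rewrite normrM normr_sg wn0 mulr1 ger0_norm// divr_ge0 // ltW.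
have ux_norm : `|t *: unit_sequence p1 n| = r / 2.
  by rewrite normrZ unit_sequence_norm mulr1.
have uxE : x + t *: unit_sequence p1 n - x = t *: unit_sequence p1 n.
  by rewrite addrAC subrr add0r.
have in_ball : ball_ Num.norm x r (x + t *: unit_sequence p1 n).
  by rewrite /ball_ /= distrC uxE ux_norm ltr_pdivrMr// ltr_pMr// ltr1n.
have neq_x : x + t *: unit_sequence p1 n != x.
  by rewrite -subr_eq0 uxE -normr_gt0 ux_norm divr_gt0.
have := ballr _ in_ball neq_x; rewrite uxE ux_norm (pairingZr qp).
have := pairing_sum_unit_sequence p1 w (s := [:: n]) (fun=> 1) isT.
rewrite !big_seq1 scale1r mul1r => ->.
have -> : t * w n = `|w n| * (r / 2).
  by rewrite mulrC /t mulrCA [w n * _]mulrC -normrEsg mulrC.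
rewrite ler_pM2r ?divr_gt0// ler_pdivlMr// ger_pMr//.
by rewrite lt_geF// ltr1n.
Qed.

(** With [r] the remainder of [f] at [x], the numerator of the quotient for a
    candidate [z'] is [<z' - z, u - x> - <y, r u>], whose second term is
    negligible compared with [`|u - x|].  As [f] grows at most linearly near
    [x], the denominator lies between two multiples of [`|u - x|].  So the
    condition on [z'] says that [<z' - z, u - x>] is at most a negligible
    quantity, which forces [z' = z]. *)
Lemma mordukhovich_derivative_differentiable (f : ell p1 -> ell q1)
    (x y : ell p1) (z : ell q1) :
  differentiable f x ->
  (forall h : ell p1, pairing z h = pairing y ('d f x h)) ->
  mordukhovich_derivative f x (f x) y = [set z].
Proof.
move=> dfx adj; have rem := differentiable_remainder dfx.
have [k k0 lip] := linear_lipschitz (diff_continuous dfx).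
pose r u := f u - f x - 'd f x (u - x).
have numE (z' : ell q1) u : pairing z' (u - x) - pairing y (f u - f x) =
    pairing (z' - z) (u - x) - pairing y (r u).
  have -> : pairing y (r u) = pairing y (f u - f x) - pairing z (u - x).
    by rewrite adj -(pairingBr pq).
  have -> : pairing (z' - z) (u - x) = pairing z' (u - x) - pairing z (u - x).
    by rewrite pairingC (pairingBr pq) pairingC [pairing _ z]pairingC.
  by rewrite opprB addrA subrK.
have small e : 0 < e -> \forall u \near x, `|pairing y (r u)| <= e * `|u - x|.
  move=> e0; have y0 : 0 < `|y| + 1 by rewrite ltr_wpDl.
  apply: filterS (rem _ (divr_gt0 e0 y0)) => u.
  rewrite -/(r u) => ru; rewrite (le_trans (pairing_le pq _ _))//.
  rewrite (@le_trans _ _ ((`|y| + 1) * (e / (`|y| + 1) * `|u - x|)))//.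
    by rewrite ler_pM// lerDl.
  by rewrite mulrA mulrCA divff ?gt_eqF// mulr1.
have growth : \forall u \near x, `|f u - f x| <= (k + 1) * `|u - x|.
  apply: filterS (rem _ ltr01) => u ru.
  rewrite -[f u - f x](subrK ('d f x (u - x))) (le_trans (ler_normD _ _))//.
  by rewrite addrC mulrDl lerD.
apply/seteqP; split=> [z' /limf_esup_le0P z'le|_ ->] /=.
  suff : z' - z = 0 by move/eqP; rewrite subr_eq0 => /eqP.
  apply: (@pairing_superlinear_eq0 x) => e e0.
  have k2 : 0 < k + 2 by rewrite addr_gt0.
  (* [e / 2] is spent on the quotient and [e / 2] on the remainder; near [x]
     the denominator is at most [k + 2] times [`|u - x|] *)
  have e2 : 0 < e / 2 by rewrite divr_gt0.
  near=> u.
  have ux0 : 0 < `|u - x|.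
    by rewrite normr_gt0 subr_eq0; near: u; exact: nbhs_dnbhs_neq.
  have : (pairing z' (u - x) - pairing y (f u - f x)) /
      (`|u - x| + `|f u - f x|) <= e / 2 / (k + 2).
    by near: u; apply: z'le; rewrite divr_gt0.
  rewrite ler_pdivrMr ?ltr_wpDr// numE lerBlDr => /le_trans; apply.
  rewrite [e in leRHS]splitr mulrDl lerD//.
    rewrite -[leLHS]mulrA ler_wpM2l ?(ltW e2)// ler_pdivrMl//.
    rewrite (_ : k + 2 = 1 + (k + 1)); last by rewrite addrCA.
    rewrite mulrDl mul1r lerD2l; near: u; exact: nbhs_dnbhs.
  rewrite (le_trans (ler_norm _))//; near: u; apply: nbhs_dnbhs.
  exact: small.
apply/limf_esup_le0P => e e0; near=> u.
have ux0 : 0 < `|u - x|.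
  by rewrite normr_gt0 subr_eq0; near: u; exact: nbhs_dnbhs_neq.
rewrite ler_pdivrMr ?ltr_wpDr// numE subrr.
have -> : pairing (0 : ell q1) (u - x) = 0.
  by rewrite pairingC -(scale0r (0 : ell q1)) (pairingZr pq) mul0r.
rewrite sub0r (le_trans (ler_norm _))// normrN mulrDr ler_wpDr//.
  by rewrite mulr_ge0// ltW.
by near: u; apply: nbhs_dnbhs; exact: small.
Unshelve. all: by end_near. Qed.

End coderivative.

(** * Derivatives of signed powers *)

Section signed_powers.
Context (R : realType).
Implicit Types (a t : R).

Definition signed_pow a t : R := `|t| `^ a * Num.sg t.

Lemma is_derive1_is_diff (f : R -> R) (t d : R) :
  is_derive t 1 f d -> is_diff t f (fun h => d * h).
Proof.
move=> dft; have df : differentiable f t.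
  by apply/derivable1_diffP; exact: ex_derive.
apply: DiffDef => //; rewrite diff1E//; apply/funext => h.
by rewrite derive1E derive_val mulrC.
Qed.

(** The sign is locally constant away from zero; hence near [t] both [`|s| ^ a]
    and its signed version are built from [(Num.sg t * s) ^ a], a power of a
    positive number. *)
Lemma near_sgr t : t != 0 -> \forall s \near t, Num.sg s = Num.sg t.
Proof.
rewrite neq_lt => /orP[t0|t0].
  near=> s; rewrite !ltr0_sg//; near: s; exact: lt_nbhsl.
near=> s; rewrite !gtr0_sg//; near: s; exact: lt_nbhsr.
Unshelve. all: by end_near. Qed.

Lemma is_derive_sgrM_powR a t : t != 0 ->
  is_derive t 1 (fun s => (Num.sg t * s) `^ a) (a * signed_pow (a - 1) t).
Proof.
move=> t0; have st0 : 0 < Num.sg t * t by rewrite -normrEsg normr_gt0.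
have dpow := is_derive1_powR a st0.
have dlin : is_derive t 1 (fun s => Num.sg t * s) (Num.sg t).
  have dZ := is_deriveZ (Num.sg t) (is_derive_id t (1 : R)).
  exact: is_derive_eq dZ (mulr1 _).
have := is_derive1_comp dpow dlin.
by rewrite -normrEsg -mulrA.
Qed.

Lemma is_diff_norm_powR a t : t != 0 ->
  is_diff t (fun s => `|s| `^ a) (fun h => a * signed_pow (a - 1) t * h).
Proof.
move=> t0.
have d : is_derive t 1 (fun s => `|s| `^ a) (a * signed_pow (a - 1) t).
  apply: near_eq_is_derive (is_derive_sgrM_powR a t0).
  by apply: filterS (near_sgr t0) => s <-; rewrite -normrEsg.
exact: is_derive1_is_diff.
Qed.

Lemma is_diff_signed_pow a t : t != 0 ->
  is_diff t (signed_pow a) (fun h => a * `|t| `^ (a - 1) * h).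
Proof.
move=> t0.
have d : is_derive t 1 (signed_pow a) (a * `|t| `^ (a - 1)).
  apply: (@near_eq_is_derive _ _ _ (fun s => Num.sg t *: (Num.sg t * s) `^ a)).
    apply: filterS (near_sgr t0) => s st.
    by rewrite -[RHS]mulrC -st -normrEsg.
  have dg := is_derive_sgrM_powR a t0.
  apply: (is_derive_eq (is_deriveZ (Num.sg t) dg)).
  rewrite -[LHS]/(_ * _) /signed_pow mulrCA; congr (_ * _).
  by rewrite mulrCA -expr2 sqr_sg t0 mulr1.
exact: is_derive1_is_diff.
Qed.

Lemma normr_signed_pow a t : a != 0 -> `|signed_pow a t| = `|t| `^ a.
Proof.
move=> a0; rewrite normrM (ger0_norm (powR_ge0 _ _)) normr_sg.
by have [->|] := eqVneq t 0; rewrite ?mulr1// normr0 powR0// mul0r.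
Qed.

Lemma mulr_signed_pow a t : 0 < a -> t * signed_pow (a - 1) t = `|t| `^ a.
Proof.
by move=> a0; rewrite mulrCA [t * _]mulrC -normrEsg mulrC mulr_powRB1.
Qed.

Lemma powR_normrM a t : 0 < a -> `|t| `^ (a - 1) * t = signed_pow a t.
Proof.
move=> a0; rewrite [t in _ * t]numEsg mulrC -mulrA mulr_powRB1//.
exact: mulrC.
Qed.

End signed_powers.

(** * Splitting a sequence along a finite set of coordinates *)

Section tail.
Context (R : realType) (p : R) (p1 : (1 <= p%:E)%E).
Variable s : seq nat.
Implicit Types u h : ell p1.

Definition tail u : ell p1 := u - \sum_(k <- s) u k *: unit_sequence p1 k.

Lemma tail_is_linear : linear tail.
Proof.
move=> a u h; rewrite /tail scalerBr addrACA -opprD; congr (_ - _).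
rewrite scaler_sumr -big_split /=; apply: eq_bigr => k _.
by rewrite scalerA -scalerDl.
Qed.

HB.instance Definition _ :=
  GRing.isLinear.Build R (ell p1) (ell p1) *:%R tail tail_is_linear.

Lemma is_diff_tail u : is_diff u tail tail.
Proof.
apply: (@is_diff_bounded_linear _ _ _ _ (1 + (size s)%:R)) => h.
rewrite (le_trans (ler_normB _ _))// mulrDl mul1r lerD2l.
rewrite (le_trans (ler_norm_sum _ _ _))// -sum1_size natr_sum mulr_suml.
apply: ler_sum => k _; rewrite mul1r normrZ unit_sequence_norm mulr1.
exact: ell_coord_le.
Qed.

Hypothesis us : uniq s.

Lemma tailE u n : tail u n = if n \in s then 0 else u n.
Proof.
rewrite -[LHS]/(u n - (\sum_(k <- s) u k *: unit_sequence p1 k) n).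
by rewrite sum_unit_sequenceE//; case: ifP; rewrite ?subrr ?subr0.
Qed.

Lemma tail_eq0 u : (forall n, n \notin s -> u n = 0) -> tail u = 0.
Proof.
by move=> u0; apply/LfuneqP => n; rewrite tailE; case: ifPn => // /u0.
Qed.

Lemma normr_ellX_tail u :
  `|u| `^ p = \sum_(k <- s) `|u k| `^ p + `|tail u| `^ p.
Proof.
have p0 := ell_exponent_gt0 p1.
rewrite normr_ellX; apply: cvg_lim => //.
pose f n := if n \in s then `|u n| `^ p else 0.
rewrite (_ : series _ =
  series f + series (fun n => `|tail u n| `^ p)); last first.
  rewrite -seriesD; congr series; apply/funext => n.
  rewrite -[RHS]/(f n + `|tail u n| `^ p) /f tailE; case: ifP => _.
    by rewrite normr0 powR0 ?gt_eqF// addr0.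
  by rewrite add0r.
apply: cvgD; last exact: cvg_ell_normX.
rewrite (_ : \sum_(k <- s) _ = \sum_(k <- s) f k).
  by apply: cvg_series_finite_support => // n /negbTE; rewrite /f => ->.
by rewrite big_seq [RHS]big_seq; apply: eq_bigr => k; rewrite /f => ->.
Qed.

(** On the support the norm power is a finite sum of scalar functions.  Off the
    support it is [`|tail s h| ^ p], whose derivative at [tail s u = 0]
    vanishes. *)
Lemma is_diff_norm_powR_ell u : 1 < p ->
  (forall n, (n \in s) = (u n != 0)) ->
  is_diff u (fun h => `|h| `^ p)
    (fun h => \sum_(k <- s) p * signed_pow (p - 1) (u k) * h k).
Proof.
move=> gt1 su.
have dhead : is_diff u (fun h => \sum_(k <- s) `|h k| `^ p)
    (fun h => \sum_(k <- s) p * signed_pow (p - 1) (u k) * h k).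
  apply: (is_diff_sum (f := fun k h => `|h k| `^ p)
    (df := fun k h => p * signed_pow (p - 1) (u k) * h k)) => k ks.
  have uk0 : ell_coord k u != 0 by rewrite -su.
  exact: is_diff_comp (is_diff_ell_coord k u) (is_diff_norm_powR p uk0).
have tu0 : tail u = 0.
  by apply: tail_eq0 => n; rewrite su negbK => /eqP.
have dtail : is_diff (tail u) (fun h : ell p1 => `|h| `^ p) (fun=> 0).
  rewrite tu0; apply: (is_diff0_superlinear gt1) => h.
  by rewrite ger0_norm// powR_ge0.
have := is_diffD dhead (is_diff_comp (is_diff_tail u) dtail).
rewrite (_ : _ + _ = fun h => `|h| `^ p); last first.
  by apply/funext => h; rewrite normr_ellX_tail.
move=> d; apply: (is_diff_eq d); apply/funext => h; exact: addr0.
Qed.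

End tail.

(** * The derivative of the duality mapping *)

Section duality_mapping_derivative.
Context (R : realType) (p q : R) (p1 : (1 <= p%:E)%E) (q1 : (1 <= q%:E)%E).
Hypothesis p2 : 2 < p.
Hypothesis pq : p^-1 + q^-1 = 1.
Local Notation J := (@duality_mapping R p q p1 q1 pq).
Implicit Types u v h : ell p1.

Let p0 : 0 < p. Proof. exact: lt_trans p2. Qed.
Let p_gt1 : 1 < p. Proof. by apply: lt_trans p2; rewrite ltr1n. Qed.
Let pB1_gt1 : 1 < p - 1. Proof. by rewrite ltrBrDr. Qed.
Let pB1_gt0 : 0 < p - 1. Proof. exact: lt_trans pB1_gt1. Qed.
Let pB1_neq0 : p - 1 != 0. Proof. by rewrite gt_eqF. Qed.

(** The map [Phi].  Defining it as a multiple of the duality mapping provides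
    the proof that its values are in l_q. *)
Definition power_map u : ell q1 := `|u| `^ (p - 2) *: duality_mapping pq u.

Lemma power_mapE u n : power_map u n = signed_pow (p - 1) (u n).
Proof.
rewrite -[LHS]/(`|u| `^ (p - 2) * duality_seq u n) /duality_seq.
have [->|u0] := eqVneq u 0.
  by rewrite mulr0 /signed_pow -[_ n]/(0 : R) sgr0 mulr0.
by rewrite mulrC divfK// gt_eqF// powR_gt0 ?normr_gt0.
Qed.

(** Conjugacy gives [(p - 1) * q = p], so the q-th powers of the entries of
    [power_map u] are the p-th powers of those of [u]. *)
Lemma normr_power_map u : `|power_map u| = `|u| `^ (p - 1).
Proof.
have q0 := ell_exponent_gt0 q1; have qN0 : q != 0 by rewrite gt_eqF.
have Xq : `|power_map u| `^ q = `|u| `^ p.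
  rewrite !normr_ellX; congr (limn (series _)); apply/funext => n.
  by rewrite power_mapE normr_signed_pow// -powRrM (conjugate_mul p1 q1 pq).
rewrite -[LHS]powRr1// -[X in _ `^ X](divff qN0) powRrM Xq -powRrM.
by rewrite -[X in X / q](conjugate_mul p1 q1 pq) mulfK.
Qed.

(** The scalar factor is written through [`|u| ^ p], the quantity that splits
    along the support.  At [u = 0] both sides vanish. *)
Lemma duality_mappingE u : J u = (`|u| `^ p) `^ ((2 - p) / p) *: power_map u.
Proof.
have [->|u0] := eqVneq u 0.
  apply/LfuneqP => n; rewrite -[LHS]/(duality_seq (0 : ell p1) n).
  rewrite -[RHS]/(_ * power_map 0 n) power_mapE /duality_seq eqxx.
  by rewrite /signed_pow -[_ n]/(0 : R) sgr0 !mulr0.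
rewrite -powRrM mulrC divfK ?gt_eqF// scalerA -powRD; last first.
  by rewrite normr_eq0 u0 implybT.
by rewrite addrA subrK subrr powRr0 scale1r.
Qed.

Variables (s : seq nat) (x : ell p1).
Hypothesis us : uniq s.
Hypothesis sx : forall n, (n \in s) = (x n != 0).
Hypothesis x0 : x != 0.

Lemma power_map_tail u : power_map u =
  \sum_(k <- s) signed_pow (p - 1) (u k) *: unit_sequence q1 k
  + power_map (tail s u).
Proof.
apply/LfuneqP => n; rewrite power_mapE.
rewrite -[RHS]/((\sum_(k <- s) _ *: unit_sequence q1 k) n
  + power_map (tail s u) n).
rewrite power_mapE tailE// sum_unit_sequenceE//; case: ifP => _.
  by rewrite /signed_pow sgr0 mulr0 addr0.
by rewrite add0r.
Qed.

(** Only the coordinates in the support contribute: the remaining ones form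
    [power_map (tail s u)], which is of order [p - 1 > 1] at [tail s x = 0]. *)
Lemma is_diff_power_map : is_diff x power_map (fun h =>
  \sum_(k <- s) ((p - 1) * `|x k| `^ (p - 2) * h k) *: unit_sequence q1 k).
Proof.
have dhead : is_diff x
    (fun u => \sum_(k <- s) signed_pow (p - 1) (u k) *: unit_sequence q1 k)
    (fun h => \sum_(k <- s)
      ((p - 1) * `|x k| `^ (p - 2) * h k) *: unit_sequence q1 k).
  apply: (is_diff_sum
    (f := fun k u => signed_pow (p - 1) (u k) *: unit_sequence q1 k)
    (df := fun k h => ((p - 1) * `|x k| `^ (p - 2) * h k)
      *: unit_sequence q1 k)) => k ks.
  have xk0 : ell_coord k x != 0 by rewrite -sx.
  have dk := is_diff_comp (is_diff_ell_coord k x)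
    (is_diff_signed_pow (p - 1) xk0).
  have := is_diff_comp dk (is_diff_scalel _ (unit_sequence q1 k)).
  by rewrite -[p - 1 - 1]addrA -opprD.
have tx0 : tail s x = 0.
  by apply: tail_eq0 => // n; rewrite sx negbK => /eqP.
have dtail : is_diff (tail s x) power_map (fun=> 0).
  rewrite tx0; apply: (is_diff0_superlinear pB1_gt1) => h.
  by rewrite normr_power_map.
have := is_diffD dhead (is_diff_comp (is_diff_tail s x) dtail).
rewrite (_ : _ + _ = power_map); last first.
  by apply/funext => u; rewrite power_map_tail.
move=> d; apply: (is_diff_eq d); apply/funext => h; exact: addr0.
Qed.

Definition duality_derivative h : ell q1 :=
  (`|x| `^ p) `^ ((2 - p) / p) *:
    \sum_(k <- s) ((p - 1) * `|x k| `^ (p - 2) * h k) *: unit_sequence q1 k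
  + ((2 - p) / p * (`|x| `^ p) `^ ((2 - p) / p - 1)
      * \sum_(k <- s) p * signed_pow (p - 1) (x k) * h k) *: power_map x.

Lemma is_diff_duality_mapping : is_diff x J duality_derivative.
Proof.
have xp0 : 0 < `|x| `^ p by rewrite powR_gt0 ?normr_gt0.
have dN := is_diff_norm_powR_ell us p_gt1 sx.
have dpow := is_derive1_is_diff (is_derive1_powR ((2 - p) / p) xp0).
have := is_diff_scale (is_diff_comp dN dpow) is_diff_power_map.
rewrite (_ : (fun u => _) = J) //.
by apply/funext => u; rewrite duality_mappingE.
Qed.

(** Paired with [w], the derivative at [h] is a diagonal bilinear form in [h]
    and [w] plus a multiple of the product of one linear form evaluated at [h]
    and at [w]. *)
Lemma duality_derivative_symmetric u v :
  pairing (duality_derivative u) v = pairing u (duality_derivative v).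
Proof.
have px : power_map x =
    \sum_(k <- s) signed_pow (p - 1) (x k) *: unit_sequence q1 k.
  rewrite power_map_tail (_ : tail s x = 0); last first.
    by apply: tail_eq0 => // n; rewrite sx negbK => /eqP.
  rewrite (_ : power_map 0 = 0) ?addr0//.
  by apply: normr0_eq0; rewrite normr_power_map normr0 powR0.
have pairE (w h : ell p1) : pairing w (duality_derivative h) =
    (`|x| `^ p) `^ ((2 - p) / p) *
      \sum_(k <- s) ((p - 1) * `|x k| `^ (p - 2) * h k) * w k
    + ((2 - p) / p * (`|x| `^ p) `^ ((2 - p) / p - 1)
      * \sum_(k <- s) p * signed_pow (p - 1) (x k) * h k)
      * \sum_(k <- s) signed_pow (p - 1) (x k) * w k.
  rewrite /duality_derivative px (pairingDr pq) !(pairingZr pq).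
  by rewrite !pairing_sum_unit_sequence.
rewrite pairingC !pairE; congr (_ * _ + _).
  by apply: eq_bigr => k _; rewrite mulrAC.
have sumE h : \sum_(k <- s) p * signed_pow (p - 1) (x k) * h k =
    p * \sum_(k <- s) signed_pow (p - 1) (x k) * h k.
  by rewrite mulr_sumr; apply: eq_bigr => k _; rewrite mulrA.
by rewrite !sumE -!mulrA; do 4 congr (_ * _); exact: mulrC.
Qed.

Lemma limn_ratio_seq v :
  limn (series (fun i => ratio_seq v x i * `|x i| `^ p)) =
  \sum_(k <- s) signed_pow (p - 1) (x k) * v k.
Proof.
apply: cvg_lim => //.
rewrite (_ : \sum_(k <- s) _ = \sum_(k <- s) ratio_seq v x k * `|x k| `^ p).
  apply: cvg_series_finite_support => // n; rewrite sx negbK => xn0.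
  by rewrite /ratio_seq xn0 mul0r.
rewrite big_seq [RHS]big_seq; apply: eq_bigr => k; rewrite sx => xk0.
by rewrite /ratio_seq (negbTE xk0) -(mulr_signed_pow _ p0) mulrA divfK// mulrC.
Qed.

Lemma duality_derivativeE v n : duality_derivative v n =
  J x n * ((p - 1) * ratio_seq v x n - (p - 2) *
    limn (series (fun i => ratio_seq v x i * `|x i| `^ p)) / `|x| `^ p).
Proof.
have xp0 : 0 < `|x| `^ p by rewrite powR_gt0 ?normr_gt0.
rewrite limn_ratio_seq duality_mappingE.
rewrite -[LHS]/(_ * (\sum_(k <- s) _ *: unit_sequence q1 k) n
  + _ * power_map x n) -[X in X * (_ - _)]/(_ * power_map x n).
rewrite sum_unit_sequenceE// power_mapE.
under eq_bigr => k _ do rewrite -mulrA.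
rewrite -mulr_sumr (_ : (`|x| `^ p) `^ ((2 - p) / p - 1) =
    (`|x| `^ p) `^ ((2 - p) / p) / `|x| `^ p); last first.
  by rewrite powRB ?(gt_eqF xp0) ?implybT// powRr1// ltW.
set N := `|x| `^ p; set c := N `^ _.
have -> : (if n \in s then (p - 1) * `|x n| `^ (p - 2) * v n else 0) =
    signed_pow (p - 1) (x n) * ((p - 1) * ratio_seq v x n).
  rewrite sx /ratio_seq; case: (eqVneq (x n) 0) => [xn0|xn0] /=.
    by rewrite !mulr0.
  rewrite -(powR_normrM _ pB1_gt0) -[p - 1 - 1]addrA -opprD.
  by rewrite [in RHS]mulrA -[RHS]mulrA; field.
have N0 : N != 0 by rewrite gt_eqF.
have pN0 : p != 0 by rewrite gt_eqF.
by field; rewrite N0 pN0.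
Qed.

End duality_mapping_derivative.

(** * The coderivative of the duality mapping *)

Theorem theorem5p1 (R : realType) (p q : R)
    (p_gt2 : 2 < p) (pq : p^-1 + q^-1 = 1)
    (xbar : ell (p_ge1 p_gt2)) (xbar_neq0 : xbar != 0)
    (xbar_fin : finite_set (nonzero_indices xbar))
    (ybar : ell (q_ge1 p_gt2 pq)) :
  let J : ell (p_ge1 p_gt2) -> ell (q_ge1 p_gt2 pq) := duality_mapping pq in
  ybar = J xbar ->
  mordukhovich_differentiable J xbar ybar /\
  differentiable J xbar /\
  forall v : ell (p_ge1 p_gt2), v != 0 ->
    let lambda := ratio_seq v xbar in
    mordukhovich_derivative J xbar ybar v = [set 'd J xbar v] /\
    'd J xbar v =
      rowseq_mul (J xbar)
        ((p - 1) *: inf_diag lambda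
         - ((p - 2) * limn (series (fun i => lambda i * `|xbar i| `^ p))
            / limn (series (fun i => `|xbar i| `^ p))) *: inf_diag (fun=> 1))
      :> (nat -> R).
Proof.
move=> J ->; have /finite_seqP[s0 s0x] := xbar_fin.
pose s := undup s0; have us : uniq s by exact: undup_uniq.
have sx n : (n \in s) = (xbar n != 0).
  have [xs sx] : nonzero_indices xbar n <-> n \in s0 by rewrite s0x.
  by rewrite mem_undup; apply/idP/idP => [/sx|/xs].
have dJ := is_diff_duality_mapping (q_ge1 p_gt2 pq) p_gt2 pq us sx xbar_neq0.
have dJx : differentiable J xbar by by case: dJ.
have dJE : 'd J xbar =
    duality_derivative (q_ge1 p_gt2 pq) pq s xbar :> (_ -> _).
  by case: dJ.
have coder v : mordukhovich_derivative J xbar (J xbar) v = [set 'd J xbar v].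
  apply: (mordukhovich_derivative_differentiable pq dJx) => h.
  by rewrite !dJE; exact: duality_derivative_symmetric.
split=> [v|]; first by exists ('d J xbar v).
split=> // v _ lambda; split; first exact: coder.
set c := _ / _.
rewrite (_ : _ - _ = inf_diag (fun n => (p - 1) * lambda n - c)).
  rewrite rowseq_mul_diag dJE; apply/funext => n.
  by rewrite duality_derivativeE// normr_ellX.
apply/funext => i; apply/funext => j.
rewrite -[LHS]/((p - 1) * inf_diag lambda i j - c * inf_diag (fun=> 1) i j).
by rewrite /inf_diag; case: ifP => _; rewrite ?mulr1// !mulr0 subrr.
Qed.
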